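(* Assume that $\mathbf A$ is symmetric positive definite, that the interface graph is two-colorable (the slab decomposition is a nonperiodic slab chain, or is periodic with $N_{\rm ds}$ even), and that the following stable-splitting assumption holds: there is a constant $C_{\rm ss}$, independent of the local mesh size and of the number of degrees of freedom used in each slab, such that $$\mathbf v^T\mathbf D_H\mathbf v\le C_{\rm ss}H^{-2}\,\mathbf v^T\mathbf T_H\mathbf v\qquad\text{for every interface vector }\mathbf v .$$ Then the matrices $\mathbf S_H=\mathbf D_H^{-1}\mathbf T_H$ and $\widetilde{\mathbf S}_H=\mathbf D_H^{-1/2}\mathbf T_H\mathbf D_H^{-1/2}$ satisfy $$C_{\rm ss}^{-1}H^2\le\lambda_{\min}\bigl(\widetilde{\mathbf S}_H\bigr)\le\lambda_{\max}\bigl(\widetilde{\mathbf S}_H\bigr)\le 2 .$$ Consequently, $$\kappa_{\mathbf D_H}(\mathbf S_H)=\kappa_2\bigl(\widetilde{\mathbf S}_H\bigr)\le 2C_{\rm ss}H^{-2}.$$ In particular, for fixed physical slab width $H$, this bound is independent of the local discretization resolution.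
   Context: Let $\mathbf A$ be a real matrix arising from a compatible discretization of a symmetric coercive elliptic Dirichlet boundary value problem on a domain decomposed into equispaced slabs of width $H>0$ separated by internal interfaces $\Gamma_1,\dots,\Gamma_{N_{\rm ds}}$ (compatible: the local discrete spaces and operators are restrictions of a single global discretization). The active degrees of freedom are partitioned into the interface set $J=J_1\cup\dots\cup J_{N_{\rm ds}}$ (disjoint union, $J_j$ corresponding to $\Gamma_j$) and the remaining slab-interior set $I$. The interface Schur complement is $$\mathbf T_H=\mathbf A_{JJ}-\mathbf A_{JI}\mathbf A_{II}^{-1}\mathbf A_{IJ},$$ with blocks $\mathbf T_{ij}=\mathbf T_H(J_i,J_j)$, and $\mathbf D_H=\operatorname{diag}(\mathbf T_{11},\dots,\mathbf T_{N_{\rm ds},N_{\rm ds}})$ is its block diagonal. $\mathbf D_H^{-1/2}$ is the inverse of the SPD square root of $\mathbf D_H$. An interface vector is a real vector indexed by $J$. Only neighbouring interfaces interact: for a nonperiodic slab chain $\mathbf T_H$ is block tridiagonal, i.e. $\mathbf T_{ij}=0$ if $|i-j|>1$; for a periodic decomposition $\mathbf T_{ij}=0$ unless $i-j\equiv0,\pm1\pmod{N_{\rm ds}}$. In the two cases considered, coloring odd-numbered interfaces red and even-numbered interfaces black gives a two-coloring in which distinct interfaces of the same color do not interact. The constant $C_{\rm ss}$ may depend on the ellipticity constants, the global domain, and the regularity of the slab decomposition. The $\mathbf D_H$-norm is $\|\mathbf x\|_{\mathbf D_H}^2=\mathbf x^T\mathbf D_H\mathbf x$, with induced operator norm, and $\kappa_{\mathbf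 D_H}(\mathbf S_H)=\|\mathbf S_H\|_{\mathbf D_H}\|\mathbf S_H^{-1}\|_{\mathbf D_H}$. $\kappa_2$ is the Euclidean (spectral-norm) condition number, and $\lambda_{\min},\lambda_{\max}$ denote the smallest and largest eigenvalues. *)

(* Defs.v *)
From mathcomp Require Import all_boot all_order all_algebra.
From mathcomp Require Import boolp classical_sets reals.

Set Implicit Arguments.
Unset Strict Implicit.
Unset Printing Implicit Defensive.

Import Order.TTheory GRing.Theory Num.Theory.

Local Open Scope classical_set_scope.
Local Open Scope ring_scope.

Section RealMatrices.
Variables (R : realType) (n : nat).
Implicit Types (M G : 'M[R]_n) (nrm : 'cV[R]_n -> R).

Definition qform M (x : 'cV[R]_n) : R := (x^T *m M *m x) 0 0.

Definition spd M : Prop :=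
  M^T = M /\ forall x : 'cV[R]_n, x != 0 -> 0 < qform M x.

(* The SPD square root; it exists and is unique when M is SPD, and the value
   is the junk 0 when there is none. *)
Definition spd_sqrt M : 'M[R]_n := xget 0 [set B | spd B /\ B *m B = M].

(* Least and greatest eigenvalues; junk 0 when there is none. *)
Definition lambda_min M : R :=
  xget 0 [set a | eigenvalue M a /\ forall b, eigenvalue M b -> a <= b].

Definition lambda_max M : R :=
  xget 0 [set a | eigenvalue M a /\ forall b, eigenvalue M b -> b <= a].

Definition norm_of G (x : 'cV[R]_n) : R := Num.sqrt (qform G x).

Definition euclid_norm : 'cV[R]_n -> R := norm_of 1%:M.

Definition opnorm nrm M : R :=
  sup [set nrm (M *m x) / nrm x | x in [set x : 'cV[R]_n | x != 0]].

Definition cond nrm M : R := opnorm nrm M * opnorm nrm (invmx M).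

Definition cond2 M : R := cond euclid_norm M.

End RealMatrices.

Inductive slab_kind := Chain | Periodic.

(* The degrees of freedom are numbered with the slab interiors I first, then
   the interface sets J_0, ..., J_(nds - 1), in this order. *)
Record slab_system (R : realType) := SlabSystem {
  kind : slab_kind;
  width : R;
  nds : nat;
  ndof_int : nat;
  ndof_if : 'I_nds -> nat;
  stiff : 'M[R]_(ndof_int + \sum_(j < nds) ndof_if j)
}.

Section SlabSystem.
Variables (R : realType) (s : slab_system R).

Definition ndof_J : nat := (\sum_(j < nds s) ndof_if j)%N.

Definition schur : 'M[R]_ndof_J :=
  drsubmx (stiff s)
  - dlsubmx (stiff s) *m invmx (ulsubmx (stiff s)) *m ursubmx (stiff s).

Definition schur_block (i j : 'I_(nds s)) : 'M[R]_(ndof_if i, ndof_if j) :=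
  submxblock schur i j.

Definition schur_diag : 'M[R]_ndof_J := \mxdiag_(j < nds s) schur_block j j.

Definition precond : 'M[R]_ndof_J := invmx schur_diag *m schur.

Definition precond_sym : 'M[R]_ndof_J :=
  invmx (spd_sqrt schur_diag) *m schur *m invmx (spd_sqrt schur_diag).

(* |i - j| <= 1, respectively i - j = 0, 1, -1 modulo the number of
   interfaces. *)
Definition neighbours (i j : 'I_(nds s)) : bool :=
  match kind s with
  | Chain => (i <= j.+1)%N && (j <= i.+1)%N
  | Periodic => [|| (i == j %[mod nds s])%N, (i == j.+1 %[mod nds s])%N
                  | (i.+1 == j %[mod nds s])%N]
  end.

Definition neighbour_coupling : Prop :=
  forall i j : 'I_(nds s), ~~ neighbours i j -> schur_block i j = 0.

Definition two_colorable : bool :=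
  match kind s with
  | Chain => true
  | Periodic => ~~ odd (nds s)
  end.

Definition stable_splitting (C : R) : Prop :=
  forall v : 'cV[R]_ndof_J,
    qform schur_diag v <= C * width s ^- 2 * qform schur v.

Definition cond_precond : R := cond (norm_of schur_diag) precond.

End SlabSystem.

(* Main.v *)
Require Import Defs.
From mathcomp Require Import all_boot all_order all_algebra.
From mathcomp Require Import boolp classical_sets reals.
From mathcomp Require Import ring lra complex.

(** Write T for the interface Schur complement, D for its block diagonal, and
    Z for the diagonal matrix with sign +1 on the interfaces of one colour and
    -1 on those of the other. Conjugation by Z leaves the diagonal blocks of T
    alone, negates the blocks that couple interfaces of different colours, and
    the remaining blocks vanish because interfaces of the same colour do not
    interact. Hence T + Z T Z = 2 D ([mxdiag_sign_flip]).

    This identity carries the upper bound. T inherits positive definiteness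
    from the stiffness matrix ([spd_schur]: T is the congruence of A by the
    discrete harmonic extension), so Z T Z is positive semidefinite, which
    gives both that D is positive definite and that T <= 2 D as quadratic
    forms. The stable splitting is the opposite comparison, c D <= T with
    c = H^2 / Css. Substituting x = D^(1/2) v turns the two comparisons into
    c |x|^2 <= x^T S x <= 2 |x|^2 for the symmetric S = D^(-1/2) T D^(-1/2).

    The eigenvalue bounds are this inequality at eigenvectors, once it is known
    that S has a least and a greatest eigenvalue; the condition number bound
    follows from |S x| <= 2 |x| and c |x| <= |S x|, which are consequences of
    the same form bounds ([qform_square_le], [qform_square_ge]). The two
    condition numbers agree because D^(1/2) is an isometry from the D-norm to
    the Euclidean norm that conjugates D^(-1) T into S ([cond_sqrt]).

    The existence of eigenvalues and of square roots rests on one fact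
    ([symmetric_spectrum]): a real symmetric matrix is annihilated by a
    polynomial with simple real roots, all of them eigenvalues. *)

Import Order.TTheory GRing.Theory Num.Theory.
Local Open Scope ring_scope.

Set Implicit Arguments.
Unset Strict Implicit.
Unset Printing Implicit Defensive.

(** * Quadratic forms and positive definite matrices *)

Section QuadraticForms.
Variable R : realType.

Lemma qformD n (M N : 'M[R]_n) x : qform (M + N) x = qform M x + qform N x.
Proof. by rewrite /qform mulmxDr mulmxDl mxE. Qed.

Lemma qformZ n a (M : 'M[R]_n) x : qform (a *: M) x = a * qform M x.
Proof. by rewrite /qform -scalemxAr -scalemxAl mxE. Qed.

Lemma qform_congr m n (P : 'M[R]_(m, n)) (M : 'M[R]_m) x :
  qform (P^T *m M *m P) x = qform M (P *m x).
Proof. by rewrite /qform trmx_mul !mulmxA. Qed.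

Lemma qform1E n (x : 'cV[R]_n) : qform 1%:M x = \sum_i x i 0 ^+ 2.
Proof.
by rewrite /qform mulmx1 mxE; apply: eq_bigr => i _; rewrite mxE expr2.
Qed.

Lemma qform1_ge0 n (x : 'cV[R]_n) : 0 <= qform 1%:M x.
Proof. by rewrite qform1E sumr_ge0 // => i _; rewrite sqr_ge0. Qed.

Lemma spd1 n : spd (1%:M : 'M[R]_n).
Proof.
split=> [|x xN0]; first exact: trmx1.
rewrite lt_neqAle qform1_ge0 andbT eq_sym.
apply: contraNneq xN0; rewrite qform1E => x0; apply/eqP/colP => i.
rewrite mxE; apply/eqP; rewrite -sqrf_eq0; apply/eqP.
by apply: (psumr_eq0P _ x0) => // j _; rewrite sqr_ge0.
Qed.

Lemma spd_qform_ge0 n (M : 'M[R]_n) x : spd M -> 0 <= qform M x.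
Proof.
move=> [_ Mpos]; have [->|/Mpos/ltW //] := eqVneq x 0.
by rewrite /qform mulmx0 mxE.
Qed.

Lemma mulmx_inj_unit n (M : 'M[R]_n) :
  (forall x : 'cV_n, M *m x = 0 -> x = 0) -> M \in unitmx.
Proof.
move=> Minj; rewrite -unitmx_tr -row_free_unit -kermx_eq0.
apply/rowV0P => v /sub_kermxP vM0.
rewrite -[v]trmxK [v^T]Minj ?trmx0 //.
by rewrite -[M]trmxK -trmx_mul vM0 trmx0.
Qed.

Lemma spd_unit n (M : 'M[R]_n) : spd M -> M \in unitmx.
Proof.
move=> [_ Mpos]; apply: mulmx_inj_unit => x Mx0; apply/eqP.
by apply: contraT => /Mpos; rewrite /qform -mulmxA Mx0 mulmx0 mxE ltxx.
Qed.

Lemma spd_invmx_tr n (M : 'M[R]_n) : spd M -> (invmx M)^T = invmx M.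
Proof. by move=> [Msym _]; rewrite trmx_inv Msym. Qed.

Lemma spd_congr m n (P : 'M[R]_(m, n)) (M : 'M[R]_m) :
  (forall x : 'cV_n, P *m x = 0 -> x = 0) -> spd M -> spd (P^T *m M *m P).
Proof.
move=> Pinj [Msym Mpos]; split=> [|x xN0].
  by rewrite !trmx_mul trmxK Msym mulmxA.
rewrite qform_congr Mpos //; apply: contraNneq xN0 => Px0.
by rewrite [x]Pinj.
Qed.

(** The vector that equals v in the last n coordinates and the discrete harmonic
    extension - A11^-1 A12 v in the first m is sent by A to the Schur complement
    applied to v, with zeros above. The Schur complement is therefore the
    congruence of A by the harmonic extension, which is injective. *)
Lemma spd_schur m n (A : 'M[R]_(m + n)) : spd A ->
  spd (drsubmx A - dlsubmx A *m invmx (ulsubmx A) *m ursubmx A).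
Proof.
move=> Aspd; have [Asym Apos] := Aspd.
have ulE : ulsubmx A
    = (col_mx 1%:M 0 : 'M_(m + n, m))^T *m A *m (col_mx 1%:M 0).
  rewrite tr_col_mx trmx1 trmx0 -[A in RHS]submxK mul_row_block.
  by rewrite !mul1mx !mul0mx !addr0 mul_row_col mulmx1 mulmx0 addr0.
have ulu : ulsubmx A \in unitmx.
  apply: spd_unit; rewrite ulE; apply: spd_congr Aspd => x.
  rewrite mul_col_mx mul1mx mul0mx.
  by move=> /(congr1 (@usubmx _ _ _ _)); rewrite col_mxKu linear0.
pose P : 'M_(m + n, n) := col_mx (- (invmx (ulsubmx A) *m ursubmx A)) 1%:M.
set S := (X in spd X).
have AP : A *m P = col_mx 0 S.
  rewrite -[A in LHS]submxK /P mul_block_col !mulmx1 !mulmxN mulKVmx //.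
  by rewrite addNr mulmxA addrC.
have -> : S = P^T *m A *m P.
  rewrite -mulmxA AP /P tr_col_mx mul_row_col mulmx0 trmx1 mul1mx.
  by rewrite add0r.
apply: spd_congr Aspd => x; rewrite /P mul_col_mx mul1mx.
by move=> /(congr1 (@dsubmx _ _ _ _)); rewrite col_mxKd linear0.
Qed.

(** Eigenvalues are defined through row vectors; the transposed eigenvector is
    the one that the quadratic form sees. *)
Lemma eigenvalue_rayleigh n (M : 'M[R]_n) a : eigenvalue M a ->
  exists2 x : 'cV_n, x != 0 & qform M x = a * qform 1%:M x.
Proof.
move=> /eigenvalueP[v vM vN0]; exists v^T; first by rewrite trmx_eq0.
by rewrite /qform trmxK vM mulmx1 -scalemxAl mxE.
Qed.

End QuadraticForms.

(** * Spectral theory of real symmetric matrices *)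

Section Spectrum.
Variable R : realType.

(** Over R[i] a real symmetric matrix is Hermitian, hence unitarily
    diagonalizable with a real diagonal d. The polynomial with simple roots at
    the entries of d annihilates the diagonal matrix, so it annihilates M, and
    this last statement involves real matrices only. Passing through an
    annihilating polynomial avoids having to find a real orthonormal eigenbasis. *)
Lemma symmetric_spectrum n (M : 'M[R]_n.+1) : M^T = M ->
  exists s : seq R, [/\ uniq s, forall a, eigenvalue M a = (a \in s)
    & horner_mx M (\prod_(a <- s) ('X - a%:P)) = 0].
Proof.
move=> Msym; pose toC := real_complex R; pose MC := map_mx toC M.
have MCherm : MC \is hermsymmx.
  apply: realsym_hermsym; first apply/is_hermitianmxP.
    by rewrite expr0 scale1r map_mx_id // /MC map_trmx Msym.
  by apply/mxOverP => i j; rewrite mxE; apply/complex_realP; eexists.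
have /orthomx_spectralP MCE := hermitian_normalmx MCherm.
have /mxOverP dreal := hermitian_spectral_diag_real MCherm.
have [d dE] : exists d : 'rV[R]_n.+1, spectral_diag MC = map_mx toC d.
  exists (map_mx (@complex.Re R) (spectral_diag MC)).
  by apply/rowP => i; rewrite !mxE /toC RRe_real.
rewrite dE in MCE.
pose s := undup [seq d 0 i | i <- enum 'I_n.+1].
have sP i : d 0 i \in s by rewrite mem_undup map_f ?mem_enum.
pose p := \prod_(a <- s) ('X - a%:P).
have horner_s : horner_mx M p = 0.
  apply: (map_mx_inj (f := toC)); rewrite map_mx0 map_horner_mx -/MC MCE.
  rewrite horner_mx_uconjC ?spectral_unit // horner_mx_diag.
  set D := diag_mx _; suff -> : D = 0 by rewrite mulmx0 mul0mx.
  apply/matrixP => i j; rewrite !mxE horner_map /=.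
  have /rootP-> : root p (d 0 i) by rewrite root_prod_XsubC.
  by rewrite rmorph0 mul0rn.
exists s; split; [exact: undup_uniq| |exact: horner_s].
move=> a; apply/idP/idP=> [|].
  rewrite eigenvalue_root_char -root_mxminpoly.
  by move/(root_dvdp (mxminpoly_min horner_s)); rewrite root_prod_XsubC.
rewrite mem_undup => /mapP[i _ ->]; rewrite -(eigenvalue_map toC) -/MC.
apply/eigenvalueP; exists (row i (spectralmx MC)).
  rewrite -row_mul [X in _ *m X]MCE !mulmxA mulmxV ?spectral_unit // mul1mx.
  by rewrite row_mul row_diag_mx -scalemxAl -rowE mxE.
apply/eqP=> /(congr1 (mulmx^~ (invmx (spectralmx MC)))).
rewrite -row_mul mulmxV ?spectral_unit // mul0mx => /rowP/(_ i)/eqP.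
by rewrite !mxE eqxx oner_eq0.
Qed.

(** Interpolation at the eigenvalues makes every function of a symmetric matrix
    a polynomial in that matrix. The inductive step corrects the value at the
    new node by a multiple of the polynomial vanishing at the old ones. *)
Lemma exists_interpolation (F : fieldType) (s : seq F) (f : F -> F) : uniq s ->
  exists p : {poly F}, {in s, forall a, p.[a] = f a}.
Proof.
elim: s => [_|a s IHs /= /andP[aNs /IHs[p pE]]]; first by exists 0.
pose w := \prod_(b <- s) ('X - b%:P).
have wa : w.[a] != 0 by rewrite -/(root _ _) root_prod_XsubC.
exists (p + ((f a - p.[a]) / w.[a]) *: w) => b.
rewrite inE hornerD hornerZ => /predU1P[->|bs].
  by rewrite divfK // addrC subrK.
have /rootP-> : root w b by rewrite root_prod_XsubC.
by rewrite mulr0 addr0 pE.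
Qed.

Lemma horner_mx_eq0 n (M : 'M[R]_n.+1) (p : {poly R}) : M^T = M ->
  (forall a, eigenvalue M a -> root p a) -> horner_mx M p = 0.
Proof.
move=> Msym rp; have [s [s_uniq sE sM]] := symmetric_spectrum Msym.
have : \prod_(a <- s) ('X - a%:P) %| p.
  apply: uniq_roots_dvdp; last by rewrite uniq_rootsE.
  by apply/allP => a; rewrite -sE => /rp.
by move=> /dvdpP[q ->]; rewrite rmorphM /= sM mulr0.
Qed.

Lemma horner_mx_tr n (M : 'M[R]_n.+1) (p : {poly R}) : M^T = M ->
  (horner_mx M p)^T = horner_mx M p.
Proof.
move=> Msym; elim/poly_ind: p => [|p c IHp]; first by rewrite rmorph0 trmx0.
rewrite rmorphD rmorphM /= horner_mx_X horner_mx_C linearD /= tr_scalar_mx.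
congr (_ + _); rewrite -[_ * M]/(_ *m M) trmx_mul IHp Msym.
exact: comm_mx_horner.
Qed.

Lemma spd_eigenvalue_gt0 n (M : 'M[R]_n) a : spd M -> eigenvalue M a -> 0 < a.
Proof.
move=> [_ Mpos] /eigenvalue_rayleigh[x xN0 xE].
by have := Mpos x xN0; rewrite xE pmulr_lgt0 // (spd1 R n).2.
Qed.

(** Let C = p(M) with p interpolating the fourth root at the eigenvalues, and
    take C^2 as the square root: as C is symmetric, the quadratic form of C^2 is
    |C x|^2, so positivity needs no eigenvector argument. *)
Lemma spd_sqrt_exists n (M : 'M[R]_n) : spd M ->
  exists B : 'M[R]_n, spd B /\ B *m B = M.
Proof.
case: n M => [|n] M Mspd.
  by exists M; split=> //; apply/matrixP; case.
have [Msym _] := Mspd; have [s [s_uniq sE _]] := symmetric_spectrum Msym.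
have [p pE] := exists_interpolation (fun a => Num.sqrt (Num.sqrt a)) s_uniq.
set C := horner_mx M p.
have Csym : C^T = C by exact: horner_mx_tr.
have C4 : C *m C *m (C *m C) = M.
  apply/eqP; rewrite -subr_eq0 -[X in _ - X]horner_mx_X.
  rewrite -[_ *m _]/(C * C * (C * C)) -!rmorphM -rmorphB /=.
  apply/eqP/horner_mx_eq0 => // a Ma.
  rewrite rootE hornerD hornerN hornerX !hornerM pE -?sE //.
  have /ltW a0 := spd_eigenvalue_gt0 Mspd Ma.
  by rewrite -!expr2 !sqr_sqrtr ?sqrtr_ge0 // subrr.
exists (C *m C); split=> //.
have -> : C *m C = C^T *m 1%:M *m C by rewrite Csym mulmx1.
apply: spd_congr (spd1 _ _) => x Cx0; have := spd_unit Mspd.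
by move/mulKmx => /(_ _ x) <-; rewrite -C4 -!mulmxA Cx0 !mulmx0.
Qed.

Lemma spd_sqrtP n (M : 'M[R]_n) : spd M ->
  spd (spd_sqrt M) /\ spd_sqrt M *m spd_sqrt M = M.
Proof.
move=> /spd_sqrt_exists[B BP].
by apply: (@xgetPex _ 0 [set B | spd B /\ B *m B = M]%classic); exists B.
Qed.

End Spectrum.

(** * Extreme eigenvalues and operator norms *)

Section ExtremeEigenvalues.
Variable R : realType.

Lemma seq_min_exists (s : seq R) : s != [::] ->
  exists2 m, m \in s & {in s, forall a, m <= a}.
Proof.
elim: s => // a [|b s] IHs _.
  by exists a => [|c]; rewrite inE // => /eqP->.
have [//|m ms mP] := IHs; have [am|ma] := leP a m.
  exists a; first by rewrite inE eqxx.
  by move=> c /predU1P[->//|/mP]; exact: le_trans.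
exists m; first by rewrite inE ms orbT.
by move=> c /predU1P[->|/mP//]; rewrite ltW.
Qed.

Lemma symmetric_spectrum_neq0 n (M : 'M[R]_n) : (0 < n)%N -> M^T = M ->
  exists2 s : seq R, s != [::] & forall a, eigenvalue M a = (a \in s).
Proof.
case: n M => // n M _ /symmetric_spectrum[s [_ sE sM]]; exists s => //.
apply: contra_eq_neq sM => ->; rewrite big_nil rmorph1.
by rewrite oner_neq0.
Qed.

Lemma lambda_minP n (M : 'M[R]_n) : (0 < n)%N -> M^T = M ->
  eigenvalue M (lambda_min M)
  /\ forall b, eigenvalue M b -> lambda_min M <= b.
Proof.
move=> n0 Msym; have [s sN0 sE] := symmetric_spectrum_neq0 n0 Msym.
have [m ms mP] := seq_min_exists sN0.
apply: (@xgetPex _ 0 [set a | eigenvalue M a /\ _]%classic); exists m.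
by split=> [|b]; rewrite sE //; exact: mP.
Qed.

Lemma lambda_maxP n (M : 'M[R]_n) : (0 < n)%N -> M^T = M ->
  eigenvalue M (lambda_max M)
  /\ forall b, eigenvalue M b -> b <= lambda_max M.
Proof.
move=> n0 Msym; have [s sN0 sE] := symmetric_spectrum_neq0 n0 Msym.
have [|m ms mP] := @seq_min_exists [seq - a | a <- s]; first by case: (s) sN0.
apply: (@xgetPex _ 0 [set a | eigenvalue M a /\ _]%classic); exists (- m).
split=> [|b]; rewrite sE; first by case/mapP: ms => a ? ->; rewrite opprK.
by move=> bs; rewrite lerNr mP // map_f.
Qed.

Lemma extreme_eigenvalues_bound n (M : 'M[R]_n) c b :
  (0 < n)%N -> M^T = M ->
  (forall x, c * qform 1%:M x <= qform M x) ->
  (forall x, qform M x <= b * qform 1%:M x) ->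
  [/\ c <= lambda_min M, lambda_min M <= lambda_max M & lambda_max M <= b].
Proof.
move=> n0 Msym Mge Mle.
have [min_eig _] := lambda_minP n0 Msym.
have [max_eig max_ub] := lambda_maxP n0 Msym.
split; last 1 first; last exact: max_ub.
  have [x xN0 xE] := eigenvalue_rayleigh max_eig.
  by have := Mle x; rewrite xE ler_pM2r // (spd1 R n).2.
have [x xN0 xE] := eigenvalue_rayleigh min_eig.
by have := Mge x; rewrite xE ler_pM2r // (spd1 R n).2.
Qed.

(** A nonempty bounded set of quotients has a nonnegative supremum; in all other
    cases the supremum takes its default value 0. *)
Lemma opnorm_ge0 n (nrm : 'cV[R]_n -> R) M :
  (forall x, 0 <= nrm x) -> 0 <= opnorm nrm M.
Proof.
move=> nrm0; rewrite /opnorm; set E := (X in sup X).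
have [Esup|/sup_out-> //] := pselect (has_sup E).
have [_ [x xN0 _]] := Esup.1.
apply: le_trans (sup_upper_bound Esup (ex_intro2 _ _ x xN0 erefl)).
by rewrite divr_ge0.
Qed.

Lemma opnorm_le n (nrm : 'cV[R]_n -> R) M b : (0 < n)%N ->
  (forall x, x != 0 -> 0 < nrm x) ->
  (forall x, nrm (M *m x) <= b * nrm x) -> opnorm nrm M <= b.
Proof.
move=> n0 nrm_gt0 Mb; apply: ge_sup.
  exists (nrm (M *m const_mx 1) / nrm (const_mx 1)), (const_mx 1) => //=.
  by apply/eqP => /colP/(_ (Ordinal n0))/eqP; rewrite !mxE oner_eq0.
by move=> _ [x /= /nrm_gt0 xN0 <-]; rewrite ler_pdivrMr.
Qed.

Lemma euclid_norm_gt0 n (x : 'cV[R]_n) : x != 0 -> 0 < euclid_norm x.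
Proof. by move=> xN0; rewrite sqrtr_gt0 (spd1 R n).2. Qed.

Lemma euclid_norm_ge0 n (x : 'cV[R]_n) : 0 <= euclid_norm x.
Proof. exact: sqrtr_ge0. Qed.

Lemma ler_euclid_norm n (x y : 'cV[R]_n) b : 0 <= b ->
  qform 1%:M x <= b ^+ 2 * qform 1%:M y ->
  euclid_norm x <= b * euclid_norm y.
Proof.
move=> b0 xy; rewrite -[b]ger0_norm // -sqrtr_sqr -sqrtrM ?sqr_ge0 //.
exact: ler_wsqrtr.
Qed.

Lemma qform_symm_mulmx n (M : 'M[R]_n) x : M^T = M ->
  qform 1%:M (M *m x) = qform (M *m M) x.
Proof. by move=> Msym; rewrite -qform_congr Msym mulmx1. Qed.

(** For 0 <= M <= b, the sum M (b - M) M + (b - M) M (b - M) of two positive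
    semidefinite matrices equals b (b M - M^2); hence M^2 <= b M <= b^2. *)
Lemma qform_square_le n (M : 'M[R]_n) b : M^T = M -> 0 < b ->
  (forall x, 0 <= qform M x) -> (forall x, qform M x <= b * qform 1%:M x) ->
  forall x, qform 1%:M (M *m x) <= b ^+ 2 * qform 1%:M x.
Proof.
move=> Msym b0 M0 Mb x; have bM0 y : 0 <= qform (b *: 1%:M - M) y.
  by rewrite -scaleN1r !(qformD, qformZ) mulN1r subr_ge0.
have Nsym : (b *: 1%:M - M)^T = b *: 1%:M - M.
  by rewrite linearB linearZ /= trmx1 Msym.
have h1 := bM0 (M *m x); have h2 := M0 ((b *: 1%:M - M) *m x).
have h3 := Mb x.
rewrite -qform_congr in h1; rewrite -qform_congr in h2.
have : 0 <= qform (b *: (b *: M - M *m M)) x.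
  rewrite (_ : b *: _ = M^T *m (b *: 1%:M - M) *m M
    + (b *: 1%:M - M)^T *m M *m (b *: 1%:M - M)) ?qformD ?addr_ge0 //.
  rewrite Nsym Msym.
  rewrite !(mulmxBr, mulmxBl, mul1mx, mulmx1, =^~ scalemxAl, =^~ scalemxAr).
  rewrite !(scalerBr, mulmxBl, =^~ scalemxAl).
  by apply/matrixP => i j; rewrite !mxE; ring.
rewrite qformZ pmulr_rge0 // -scaleN1r qformD !qformZ mulN1r subr_ge0.
rewrite -qform_symm_mulmx // => /le_trans; apply.
by rewrite expr2 -mulrA ler_wpM2l // ltW.
Qed.

(** Expand 0 <= |M x - c x|^2 = |M x|^2 - 2 c x^T M x + c^2 |x|^2 and bound the
    middle term by the hypothesis. *)
Lemma qform_square_ge n (M : 'M[R]_n) c : M^T = M -> 0 < c ->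
  (forall x, c * qform 1%:M x <= qform M x) ->
  forall x, c ^+ 2 * qform 1%:M x <= qform 1%:M (M *m x).
Proof.
move=> Msym c0 Mc x; have := qform1_ge0 ((M - c *: 1%:M) *m x).
have Nsym : (M - c *: 1%:M)^T = M - c *: 1%:M.
  by rewrite linearB linearZ /= trmx1 Msym.
rewrite -qform_congr Nsym mulmx1.
rewrite (_ : _ *m _ = M *m M + ((- (2 * c)) *: M + (c ^+ 2) *: 1%:M)).
  rewrite !(qformD, qformZ) -qform_symm_mulmx // => h; have := Mc x.
  rewrite -(ler_pM2l c0); lra.
rewrite !(mulmxBr, mulmxBl, mul1mx, mulmx1, =^~ scalemxAl, =^~ scalemxAr).
by apply/matrixP => i j; rewrite !mxE; ring.
Qed.

Lemma cond2_le n (M : 'M[R]_n) c b : (0 < n)%N -> M^T = M ->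
  0 < c -> 0 < b ->
  (forall x, c * qform 1%:M x <= qform M x) ->
  (forall x, qform M x <= b * qform 1%:M x) ->
  cond2 M <= b / c.
Proof.
move=> n0 Msym c0 b0 Mge Mle.
have Mspd : spd M.
  split=> // x xN0; apply: lt_le_trans (Mge x).
  by rewrite mulr_gt0 // (spd1 R n).2.
apply: ler_pM; rewrite ?opnorm_ge0 //; try exact: euclid_norm_ge0.
  apply: opnorm_le => // [x|x]; first exact: euclid_norm_gt0.
  apply: ler_euclid_norm; first exact: ltW.
  by apply: qform_square_le => // y; exact: spd_qform_ge0.
apply: opnorm_le => // [x|x]; first exact: euclid_norm_gt0.
apply: ler_euclid_norm; first by rewrite invr_ge0 ltW.
have := qform_square_ge Msym c0 Mge (invmx M *m x).
by rewrite mulKVmx ?spd_unit // exprVn ler_pdivlMl ?exprn_gt0.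
Qed.

(** B maps the D-norm isometrically to the Euclidean norm, so the two operator
    norms are suprema of the same set of quotients, reindexed by y = B x. *)
Lemma opnorm_sqrt n (D B M : 'M[R]_n) : spd B -> B *m B = D ->
  opnorm (norm_of D) M = opnorm (@euclid_norm R n) (B *m M *m invmx B).
Proof.
move=> Bspd BB; have Bu := spd_unit Bspd.
have nD x : norm_of D x = euclid_norm (B *m x).
  by rewrite /euclid_norm /norm_of -qform_congr Bspd.1 mulmx1 BB.
congr sup; apply/seteqP; split=> _ [x /= xN0 <-].
  exists (B *m x); last by rewrite -!mulmxA mulKmx // !nD.
  by apply: contraNneq xN0 => Bx0; rewrite -(mulKmx Bu x) Bx0 mulmx0.
exists (invmx B *m x); last by rewrite !nD mulKVmx // !mulmxA.
by apply: contraNneq xN0 => Bx0; rewrite -(mulKVmx Bu x) Bx0 mulmx0.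
Qed.

Lemma invmx_mul n (M N : 'M[R]_n) : M \in unitmx -> N \in unitmx ->
  invmx (M *m N) = invmx N *m invmx M.
Proof.
move=> Mu Nu; have MNu : M *m N \in unitmx by rewrite unitmx_mul Mu.
by rewrite -[RHS](mulKmx MNu) -!mulmxA mulKVmx // mulmxV // mulmx1.
Qed.

(** Conjugating D^-1 T by B = D^(1/2) gives B^-1 T B^-1, and the inverses are
    conjugated in the same way. *)
Lemma cond_sqrt n (D B T : 'M[R]_n) : spd B -> B *m B = D -> T \in unitmx ->
  cond (norm_of D) (invmx D *m T) = cond2 (invmx B *m T *m invmx B).
Proof.
move=> Bspd BB Tu; have Bu := spd_unit Bspd.
have Du : D \in unitmx by rewrite -BB unitmx_mul Bu.
rewrite /cond2 /cond !(opnorm_sqrt _ Bspd BB).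
congr (_ * _); congr opnorm.
  by rewrite -BB invmx_mul // !mulmxA mulmxV // mul1mx.
rewrite !invmx_mul ?(unitmx_mul, unitmx_inv) ?Bu ?Du ?Tu // !invmxK -BB.
by rewrite !mulmxA mulmxK.
Qed.

End ExtremeEigenvalues.

(** * Red-black sign flip of the interface Schur complement *)

Section SlabSystems.
Variable R : realType.
Implicit Type s : slab_system R.

(** Parity of the interface index is the red-black colouring. *)
Definition sign_flip n (p_ : 'I_n -> nat) : 'M[R]_(\sum_(j < n) p_ j) :=
  \mxdiag_(j < n) ((-1) ^+ j)%:M.

Lemma sign_flip_tr n (p_ : 'I_n -> nat) : (sign_flip p_)^T = sign_flip p_.
Proof. by rewrite tr_mxdiag; apply: eq_mxdiag => j; exact: tr_scalar_mx. Qed.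

(** The (i, j) block of Z T Z is (-1)^(i + j) times that of T: equal to it on
    the diagonal, opposite to it between different colours, and zero
    together with it between distinct interfaces of the same colour. *)
Lemma mxdiag_sign_flip n (p_ : 'I_n -> nat) (T : 'M[R]_(\sum_(j < n) p_ j)) :
  (forall i j : 'I_n, odd i = odd j -> i != j -> submxblock T i j = 0) ->
  (\mxdiag_(j < n) submxblock T j j) + (\mxdiag_(j < n) submxblock T j j)
  = T + sign_flip p_ *m T *m sign_flip p_.
Proof.
move=> T0; apply/mxblockP => i j.
rewrite -[X in sign_flip p_ *m X]submxblockK.
rewrite mul_mxdiag_mxblock mul_mxblock_mxdiag !submxblockD !mxblockK.
rewrite mul_scalar_mx mul_mx_scalar scalerA.
rewrite -signr_odd -(signr_odd _ i) -signr_addb.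
have [<-|ijN] := eqVneq i j; first by rewrite addbb scale1r conform_mx_id.
rewrite addr0; have [ij|] := eqVneq (odd i) (odd j).
  by rewrite T0 // scaler0 addr0.
by case: odd; case: odd => // _; rewrite scaleN1r subrr.
Qed.

(** On a periodic chain this is where the evenness of the number of interfaces
    enters: reduction modulo an even number preserves parity, so the wrap-around
    neighbours also have opposite colours. *)
Lemma same_color_not_neighbours s (i j : 'I_(nds s)) : two_colorable s ->
  odd i = odd j -> i != j -> ~~ neighbours i j.
Proof.
rewrite /two_colorable /neighbours; case: (kind s) => [_|Nodd] ij.
  rewrite -val_eqE /= neq_ltn => /orP[] lt_ij.
    rewrite negb_and -!ltnNge; apply/orP; right.
    rewrite ltn_neqAle lt_ij andbT; apply: contra_eq_neq ij => <- /=.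
    by case: odd.
  rewrite negb_and -!ltnNge; apply/orP; left.
  rewrite ltn_neqAle lt_ij andbT; apply: contra_eq_neq ij => <- /=.
  by case: odd.
have oddE m k : m = k %[mod nds s] -> odd m = odd k.
  move=> mk; rewrite (divn_eq m (nds s)) (divn_eq k (nds s)) !oddD !oddM.
  by rewrite (negbTE Nodd) !andbF mk.
move=> ijN; rewrite !negb_or; apply/and3P; split.
- by rewrite !modn_small.
- by apply/eqP => /oddE /=; rewrite ij; case: odd.
- by apply/eqP => /oddE /=; rewrite ij; case: odd.
Qed.

Lemma qform_schur_diag s v : neighbour_coupling s -> two_colorable s ->
  2 * qform (schur_diag s) v
  = qform (schur s) v + qform (schur s) (sign_flip (@ndof_if _ s) *m v).
Proof.
move=> coupling col.
have flip : schur_diag s + schur_diag s = schur s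
    + sign_flip (@ndof_if _ s) *m schur s *m sign_flip (@ndof_if _ s).
  apply: mxdiag_sign_flip => i j ij ijN.
  exact/coupling/same_color_not_neighbours.
rewrite mulr_natl mulr2n -qformD flip qformD.
by rewrite -[in RHS]qform_congr sign_flip_tr.
Qed.

Lemma schur_spd s : spd (stiff s) -> spd (schur s).
Proof. exact: spd_schur. Qed.

Lemma schur_diag_spd s : neighbour_coupling s -> two_colorable s ->
  spd (stiff s) -> spd (schur_diag s).
Proof.
move=> coupling col /schur_spd Tspd; have [Tsym Tpos] := Tspd; split.
  rewrite tr_mxdiag; apply: eq_mxdiag => j.
  by rewrite /schur_block tr_submxblock Tsym.
move=> v vN0; rewrite -(pmulr_rgt0 _ (ltr0n _ 2)) qform_schur_diag //.
by rewrite ltr_wpDr ?Tpos // spd_qform_ge0.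
Qed.

Lemma qform_schur_le s v : neighbour_coupling s -> two_colorable s ->
  spd (stiff s) -> qform (schur s) v <= 2 * qform (schur_diag s) v.
Proof.
move=> coupling col /schur_spd Tspd.
by rewrite qform_schur_diag // lerDl spd_qform_ge0.
Qed.

End SlabSystems.

(** * The symmetrically preconditioned Schur complement *)

Section Preconditioned.
Variables (R : realType) (s : slab_system R).
Hypotheses (coupling : neighbour_coupling s) (colorable : two_colorable s).
Hypothesis stiff_spd : spd (stiff s).

Let Dspd : spd (schur_diag s) := schur_diag_spd coupling colorable stiff_spd.
Let Tspd : spd (schur s) := schur_spd stiff_spd.

Lemma precond_sym_tr : (precond_sym s)^T = precond_sym s.
Proof.
have [Bspd _] := spd_sqrtP Dspd.
by rewrite /precond_sym !trmx_mul (spd_invmx_tr Bspd) Tspd.1 mulmxA.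
Qed.

Lemma qform_precond_sym x :
  qform (precond_sym s) x
  = qform (schur s) (invmx (spd_sqrt (schur_diag s)) *m x).
Proof.
have [Bspd _] := spd_sqrtP Dspd.
by rewrite -qform_congr (spd_invmx_tr Bspd).
Qed.

Lemma qform_schur_diag_sqrt x :
  qform (schur_diag s) (invmx (spd_sqrt (schur_diag s)) *m x) = qform 1%:M x.
Proof.
have [Bspd BB] := spd_sqrtP Dspd; have Bu := spd_unit Bspd.
rewrite -qform_congr (spd_invmx_tr Bspd) -[X in _ *m X *m _]BB.
by rewrite mulmxA mulVmx // mul1mx mulmxV.
Qed.

Lemma precond_sym_le x : qform (precond_sym s) x <= 2 * qform 1%:M x.
Proof.
by rewrite qform_precond_sym -qform_schur_diag_sqrt qform_schur_le.
Qed.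

(** The splitting inequality at any nonzero interface vector compares two
    positive numbers, which forces the sign of the constant. *)
Lemma splitting_const_gt0 C : (0 < ndof_J s)%N -> 0 < width s ->
  stable_splitting s C -> 0 < C.
Proof.
move=> J0 w0 split_C; pose v : 'cV[R]_(ndof_J s) := const_mx 1.
have vN0 : v != 0.
  by apply/eqP => /colP/(_ (Ordinal J0))/eqP; rewrite !mxE oner_eq0.
have := lt_le_trans (Dspd.2 v vN0) (split_C v).
by rewrite pmulr_lgt0 ?Tspd.2 // pmulr_lgt0 // invr_gt0 exprn_gt0.
Qed.

Lemma precond_sym_ge C x : 0 < width s -> 0 < C -> stable_splitting s C ->
  C^-1 * width s ^+ 2 * qform 1%:M x <= qform (precond_sym s) x.
Proof.
move=> w0 C0 split_C; rewrite qform_precond_sym -qform_schur_diag_sqrt.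
rewrite -mulrA ler_pdivrMl // mulrC -ler_pdivlMr ?exprn_gt0 //.
by rewrite mulrAC; exact: split_C.
Qed.

End Preconditioned.

Unset Implicit Arguments.
Set Strict Implicit.
Set Printing Implicit Defensive.

Theorem theorem4p3 (R : realType) (Disc : Type) (sys : Disc -> slab_system R)
    (Css : R)
    (width_gt0 : forall d, 0 < width (sys d))
    (J_neq0 : forall d, (0 < ndof_J (sys d))%N)
    (coupling : forall d, neighbour_coupling (sys d))
    (A_spd : forall d, spd (stiff (sys d)))
    (colorable : forall d, two_colorable (sys d))
    (splitting : forall d, stable_splitting (sys d) Css) :
  (forall d,
    [/\ Css^-1 * width (sys d) ^+ 2 <= lambda_min (precond_sym (sys d)),
        lambda_min (precond_sym (sys d)) <= lambda_max (precond_sym (sys d))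
      & lambda_max (precond_sym (sys d)) <= 2])
  /\ (forall d,
        cond_precond (sys d) = cond2 (precond_sym (sys d))
        /\ cond2 (precond_sym (sys d)) <= 2 * Css * width (sys d) ^- 2)
  /\ (forall H : R, 0 < H -> exists K : R,
        forall d, width (sys d) = H -> cond_precond (sys d) <= K).
Proof.
have Css_gt0 (d : Disc) : 0 < Css.
  exact: (splitting_const_gt0 (coupling d) (colorable d) (A_spd d)
    (J_neq0 d) (width_gt0 d) (splitting d)).
have c_gt0 d : 0 < Css^-1 * width (sys d) ^+ 2.
  by rewrite mulr_gt0 ?invr_gt0 ?exprn_gt0 ?(Css_gt0 d).
have lower d x : Css^-1 * width (sys d) ^+ 2 * qform 1%:M x
    <= qform (precond_sym (sys d)) x.
  by apply: precond_sym_ge => //; exact: Css_gt0 d.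
have upper d x : qform (precond_sym (sys d)) x <= 2 * qform 1%:M x.
  exact: precond_sym_le.
have sym d : (precond_sym (sys d))^T = precond_sym (sys d).
  exact: precond_sym_tr.
have condE d : cond_precond (sys d) = cond2 (precond_sym (sys d)).
  have Dspd := schur_diag_spd (coupling d) (colorable d) (A_spd d).
  have [Bspd BB] := spd_sqrtP Dspd.
  by apply: cond_sqrt => //; apply/spd_unit/schur_spd.
have cond_bound d :
    cond2 (precond_sym (sys d)) <= 2 * Css * width (sys d) ^- 2.
  have := cond2_le (J_neq0 d) (sym d) (c_gt0 d) (ltr0n _ 2) (lower d) (upper d).
  by rewrite invfM invrK mulrA.
split=> [d|]; first exact: extreme_eigenvalues_bound.
split=> [d|H _]; first by split.
by exists (2 * Css * H ^- 2) => d dH; rewrite condE -dH.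
Qed.
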